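(* Let $(M,\varphi_i,\xi_i,\eta_i,g)$, $i=1,2,3$, be a canonical almost $3$-contact metric manifold of dimension $4n+3$, $n\ge1$, let $\nabla$ be its canonical connection, $\beta$ its Reeb Killing function, and $\nabla^i$ ($i=1,2,3$) the characteristic connections of the three almost contact metric structures $(\varphi_i,\xi_i,\eta_i,g)$. Then, for every even permutation $(i,j,k)$ of $(1,2,3)$, $$\nabla=\nabla^i-\frac{\beta}{2}(\eta_j\wedge\Phi_j+\eta_k\wedge\Phi_k),$$ that is, $g(\nabla_XY,Z)=g(\nabla^i_XY,Z)-\frac\beta2(\eta_j\wedge\Phi_j+\eta_k\wedge\Phi_k)(X,Y,Z)$ for all vector fields $X,Y,Z$.
   Context: An almost contact metric structure $(\varphi,\xi,\eta,g)$ consists of a $(1,1)$-tensor field $\varphi$, a vector field $\xi$, a $1$-form $\eta$ and a Riemannian metric $g$ with $\varphi^2=-I+\eta\otimes\xi$, $\eta(\xi)=1$, $g(\varphi X,\varphi Y)=g(X,Y)-\eta(X)\eta(Y)$. Its fundamental form is $\Phi(X,Y)=g(X,\varphi Y)$, and $N_\varphi(X,Y)=[\varphi X,\varphi Y]+\varphi^2[X,Y]-\varphi[\varphi X,Y]-\varphi[X,\varphi Y]+d\eta(X,Y)\xi$, $N_\varphi(X,Y,Z)=g(N_\varphi(X,Y),Z)$. A metric connection has skew torsion if $T(X,Y,Z)=g(T(X,Y),Z)$ is a $3$-form. A characteristic connection of $(\varphi,\xi,\eta,g)$ is a metric connection with skew torsion such that $\nabla\eta=\nabla\varphi=0$; it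 is unique if it exists. An almost $3$-contact metric manifold $(M,\varphi_i,\xi_i,\eta_i,g)$, $i=1,2,3$, is a manifold of dimension $4n+3$ with three almost contact metric structures with the same $g$ such that, for every even permutation $(i,j,k)$ of $(1,2,3)$, $\varphi_k=\varphi_i\varphi_j-\eta_j\otimes\xi_i=-\varphi_j\varphi_i+\eta_i\otimes\xi_j$, $\xi_k=\varphi_i\xi_j=-\varphi_j\xi_i$, $\eta_k=\eta_i\circ\varphi_j=-\eta_j\circ\varphi_i$. Set $\mathcal H=\bigcap_i\ker\eta_i$. For $X,Y\in\Gamma(\mathcal H)$ let $A_{ij}(X,Y)=g((\mathcal L_{\xi_j}\varphi_i)X,Y)+d\eta_j(X,\varphi_iY)+d\eta_j(\varphi_iX,Y)$, $A_i=A_{ii}$. $M$ admits a Reeb Killing function $\beta\in C^\infty(M)$ if $A_i(X,Y)=0$ and $A_{ij}(X,Y)=-A_{ji}(X,Y)=\beta\Phi_k(X,Y)$ for all $X,Y\in\Gamma(\mathcal H)$ and every even permutation $(i,j,k)$ of $(1,2,3)$. $M$ is canonical if: 1) each $N_{\varphi_i}$ is skew-symmetric on $\mathcal H$ (i.e. $N_{\varphi_i}(X,Y,Z)$ restricted to $\mathcal H$ is a $3$-form); 2) each $\xi_i$ is Killing; 3) $N_{\varphi_i}(X,Y,Z)-d\Phi_i(\varphi_iX,\varphi_iY,\varphi_iZ)=N_{\varphi_j}(X,Y,Z)-d\Phi_j(\varphi_jX,\varphi_jY,\varphi_jZ)$ for all $X,Y,Z\in\Gamma(\mathcal H)$ and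 all $i,j$; 4) $M$ admits a Reeb Killing function $\beta$. On a canonical manifold each structure $(\varphi_i,\xi_i,\eta_i,g)$ admits a characteristic connection. The canonical connection of a canonical manifold is the unique metric connection $\nabla$ with skew torsion such that $\nabla_X\varphi_i=\beta(\eta_k(X)\varphi_j-\eta_j(X)\varphi_k)$ for all $X$ and every even permutation $(i,j,k)$ of $(1,2,3)$, $\beta$ being the Reeb Killing function. Conventions: $d\eta(X,Y)=X(\eta(Y))-Y(\eta(X))-\eta([X,Y])$, $(\eta\wedge\Phi)(X,Y,Z)=\eta(X)\Phi(Y,Z)+\eta(Y)\Phi(Z,X)+\eta(Z)\Phi(X,Y)$, and analogously (no numerical factors) in general. *)

(* Defs.v *)
(* Setting: MathComp + MathComp-Analysis.

   The libraries have no smooth manifolds, so these are set up here: a manifold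
   carries an atlas, C^oo(M) is a commutative ring, vector fields are the
   derivations of C^oo(M), and tensor fields are C^oo(M)-multilinear maps on
   vector fields. *)
From HB Require Import structures.
From mathcomp Require Import all_boot all_order all_algebra all_fingroup.
From mathcomp Require Import all_classical all_reals all_analysis.
From mathcomp Require Import ring.

Set Implicit Arguments.
Unset Strict Implicit.
Unset Printing Implicit Defensive.

Import Order.TTheory GRing.Theory Num.Theory.
Import numFieldNormedType.Exports.

Local Open Scope classical_set_scope.
Local Open Scope ring_scope.

(** * Smooth functions on open subsets of R^m *)

(* To be used with U open: continuity and derivatives are those of the ambient
   space at the points of U. *)
Fixpoint Ck_on (R : realType) (m k : nat) (U : set 'rV[R]_m)
    (f : 'rV[R]_m -> R) : Prop :=
  (forall x, U x -> {for x, continuous f}) /\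
  match k with
  | 0 => True
  | k'.+1 => forall i : 'I_m,
      (forall x, U x -> derivable f x (delta_mx 0 i)) /\
      Ck_on k' U (fun x => 'D_(delta_mx 0 i) f x)
  end.

Definition smooth_on (R : realType) (m : nat) (U : set 'rV[R]_m)
    (f : 'rV[R]_m -> R) : Prop := forall k, Ck_on k U f.

Section SmoothOnTheory.
Variables (R : realType) (m : nat) (U : set 'rV[R]_m).
Hypothesis openU : open U.
Implicit Types f g : 'rV[R]_m -> R.

Lemma Ck_on_ext k f g :
  (forall x, U x -> f x = g x) -> Ck_on k U f -> Ck_on k U g.
Proof.
have near_eq (f' g' : 'rV[R]_m -> R) x : (forall y, U y -> f' y = g' y) ->
    U x -> \near x, f' x = g' x.
  by move=> fg Ux; apply: filterS (open_nbhs_nbhs (conj openU Ux)) => y /fg.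
elim: k f g => [|k IH] f g fg [cf df].
  split=> // x Ux; rewrite /prop_for /continuous_at -(fg _ Ux).
  exact: cvg_trans (near_eq_cvg (near_eq _ _ _ fg Ux)) (cf _ Ux).
split=> [x Ux|i].
  rewrite /prop_for /continuous_at -(fg _ Ux).
  exact: cvg_trans (near_eq_cvg (near_eq _ _ _ fg Ux)) (cf _ Ux).
have [dfi Cfi] := df i; split=> [x Ux|].
  exact: near_eq_derivable (near_eq _ _ _ fg Ux) (dfi _ Ux).
apply: IH Cfi => x Ux; apply: near_eq_derive; exact: near_eq fg Ux.
Qed.

Lemma Ck_onW k f : Ck_on k.+1 U f -> Ck_on k U f.
Proof.
elim: k f => [|k IH] f [cf df]; split=> // i.
by have [dfi Cfi] := df i; split=> //; exact: IH.
Qed.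

Lemma Ck_on_cst k (a : R) : Ck_on k U (fun=> a).
Proof.
elim: k a => [|k IH] a; split=> //.
- by move=> x _; exact: cst_continuous.
- by move=> x _; exact: cst_continuous.
move=> i; split=> [x _|]; first exact: derivable_cst.
by apply: Ck_on_ext (IH 0) => x _; rewrite derive_cst.
Qed.

Lemma Ck_onD k f g : Ck_on k U f -> Ck_on k U g -> Ck_on k U (f + g).
Proof.
elim: k f g => [|k IH] f g [cf df] [cg dg].
  by split=> // x Ux; exact: (cvgD (cf _ Ux) (cg _ Ux)).
split=> [x Ux|i]; first exact: (cvgD (cf _ Ux) (cg _ Ux)).
have [dfi Cfi] := df i; have [dgi Cgi] := dg i; split=> [x Ux|].
  by apply: derivableD; [exact: dfi|exact: dgi].
apply: Ck_on_ext (IH _ _ Cfi Cgi) => x Ux.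
by rewrite deriveD //; [exact: dfi|exact: dgi].
Qed.

Lemma Ck_onM k f g : Ck_on k U f -> Ck_on k U g -> Ck_on k U (f * g).
Proof.
elim: k f g => [|k IH] f g Cf Cg; have [[cf df] [cg dg]] := (Cf, Cg).
  by split=> // x Ux; exact: (cvgM (cf _ Ux) (cg _ Ux)).
split=> [x Ux|i]; first exact: (cvgM (cf _ Ux) (cg _ Ux)).
have [dfi Cfi] := df i; have [dgi Cgi] := dg i; split=> [x Ux|].
  by apply: derivableM; [exact: dfi|exact: dgi].
apply: Ck_on_ext
  (Ck_onD (IH _ _ (Ck_onW Cf) Cgi) (IH _ _ (Ck_onW Cg) Cfi)) => x Ux.
by rewrite deriveM //; [exact: dfi|exact: dgi].
Qed.

End SmoothOnTheory.

(** * Smooth manifolds *)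

Record chart (R : realType) (m : nat) (T : topologicalType) := Chart {
  chart_dom : set T;
  chart_map :> T -> 'rV[R]_m;
  chart_inv : 'rV[R]_m -> T;
  chart_dom_open : open chart_dom;
  chart_img_open : open (chart_map @` chart_dom);
  chart_invK : forall p, chart_dom p -> chart_inv (chart_map p) = p;
  chart_map_continuous :
    forall p, chart_dom p -> {for p, continuous chart_map};
  chart_inv_continuous :
    forall x, (chart_map @` chart_dom) x -> {for x, continuous chart_inv} }.

Definition smooth_compatible (R : realType) (m : nat) (T : topologicalType)
    (c c' : chart R m T) : Prop :=
  forall i : 'I_m, smooth_on (c @` (chart_dom c `&` chart_dom c'))
                             (fun x => c' (chart_inv c x) 0 i).

(* The atlas need not be maximal. *)
Record manifold (R : realType) (m : nat) := Manifold {
  mcarrier :> topologicalType;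
  atlas : set (chart R m mcarrier);
  atlas_cover : forall p : mcarrier, exists2 c, atlas c & chart_dom c p;
  atlas_compatible :
    forall c c', atlas c -> atlas c' -> smooth_compatible c c';
  mcarrier_hausdorff : hausdorff_space mcarrier;
  mcarrier_second_countable : @second_countable mcarrier }.

(** * The ring of smooth functions *)

Definition smooth (R : realType) (m : nat) (M : manifold R m) :
    {pred M -> R} :=
  mem [set f : M -> R | forall c, @atlas _ _ M c ->
    smooth_on (c @` chart_dom c) (f \o chart_inv c)].
Arguments smooth {R m} M _.

Record smooth_fun (R : realType) (m : nat) (M : manifold R m) := SmoothFun {
  smooth_fun_val :> M -> R;
  smooth_funP : smooth_fun_val \in smooth M }.

Section SmoothFunRing.
Variables (R : realType) (m : nat) (M : manifold R m).
Local Notation F := (smooth_fun M).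

HB.instance Definition _ := [isSub for @smooth_fun_val R m M].
HB.instance Definition _ := [Choice of F by <:].

Lemma smooth_cst (a : R) : (cst a : M -> R) \in smooth M.
Proof.
by rewrite inE => c Mc k; apply: (Ck_on_cst (@chart_img_open _ _ _ c)).
Qed.

Fact smooth_subring : subring_closed (smooth M).
Proof.
have sM (f g : M -> R) :
    f \in smooth M -> g \in smooth M -> f * g \in smooth M.
  rewrite !inE => sf sg c Mc k.
  apply: (Ck_onM (@chart_img_open _ _ _ c) (f := f \o _) (g := g \o _)).
    exact: sf.
  exact: sg.
have sD (f g : M -> R) :
    f \in smooth M -> g \in smooth M -> f + g \in smooth M.
  rewrite !inE => sf sg c Mc k.
  apply: (Ck_onD (@chart_img_open _ _ _ c) (f := f \o _) (g := g \o _)).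
    exact: sf.
  exact: sg.
split=> [|f g sf sg|//]; first exact: smooth_cst.
rewrite (_ : f - g = f + cst (-1) * g); last first.
  by apply/funext => p; rewrite !fctE mulN1r.
by apply: sD => //; apply: sM => //; exact: smooth_cst.
Qed.

HB.instance Definition _ :=
  GRing.SubChoice_isSubComPzRing.Build _ _ F smooth_subring.

Definition smooth_scale (a : R) (f : F) : F := SmoothFun (smooth_cst a) * f.

Fact smooth_scaleA a b f :
  smooth_scale a (smooth_scale b f) = smooth_scale (a * b) f.
Proof. by apply/val_inj/funext => p /=; rewrite !fctE /cst mulrA. Qed.
Fact smooth_scale1 : left_id 1 smooth_scale.
Proof. by move=> f; apply/val_inj/funext => p /=; rewrite !fctE /cst mul1r. Qed.
Fact smooth_scaleDr : right_distributive smooth_scale +%R.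
Proof. by move=> a f g; rewrite /smooth_scale mulrDr. Qed.
Fact smooth_scaleDl f : {morph smooth_scale^~ f : a b / a + b}.
Proof.
by move=> a b; apply/val_inj/funext => p /=; rewrite !fctE /cst mulrDl.
Qed.

HB.instance Definition _ := GRing.Zmodule_isLmodule.Build R F
  smooth_scaleA smooth_scale1 smooth_scaleDr smooth_scaleDl.

Lemma smooth_funDE (f g : F) p : (f + g) p = f p + g p. Proof. by []. Qed.
Lemma smooth_funNE (f : F) p : (- f) p = - f p. Proof. by []. Qed.
Lemma smooth_funME (f g : F) p : (f * g) p = f p * g p. Proof. by []. Qed.
Lemma smooth_funZE (a : R) (f : F) p : (a *: f) p = a * f p. Proof. by []. Qed.

Lemma smooth_scalerAl (a : R) (f g : F) : a *: (f * g) = a *: f * g.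
Proof. exact: mulrA. Qed.

End SmoothFunRing.

(** * Vector fields: the derivations of C^oo(M) *)

Definition derivation (R : realType) (m : nat) (M : manifold R m) :
    {pred smooth_fun M -> smooth_fun M} :=
  mem [set X : smooth_fun M -> smooth_fun M |
    (forall (a : R) f g, X (a *: f + g) = a *: X f + X g) /\
    (forall f g, X (f * g) = X f * g + f * X g)].
Arguments derivation {R m} M _.

Record vfield (R : realType) (m : nat) (M : manifold R m) := VField {
  vfield_val :> smooth_fun M -> smooth_fun M;
  vfieldP : vfield_val \in derivation M }.

Section VFieldModule.
Variables (R : realType) (m : nat) (M : manifold R m).
Local Notation F := (smooth_fun M).
Local Notation V := (vfield M).

HB.instance Definition _ := [isSub for @vfield_val R m M].
HB.instance Definition _ := [Choice of V by <:].

Fact derivation_zmod : zmod_closed (derivation M).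
Proof.
have fun0E (f : F) : (0 : F -> F) f = 0 by [].
have funBE (X Y : F -> F) f : (X - Y) f = X f - Y f by [].
split=> [|X Y]; rewrite !inE /=.
  by split=> *; rewrite !fun0E ?(scaler0, mul0r, mulr0, addr0).
move=> [lX dX] [lY dY]; split=> *; rewrite !funBE ?lX ?lY ?dX ?dY.
  by rewrite scalerBr opprD addrACA.
by rewrite mulrBl mulrBr opprD addrACA.
Qed.

HB.instance Definition _ :=
  GRing.SubChoice_isSubZmodule.Build _ _ V derivation_zmod.

Lemma vfield_linear (X : V) (a : R) f g : X (a *: f + g) = a *: X f + X g.
Proof. by case: X => X /=; rewrite inE => -[->]. Qed.

Lemma vfield_leibniz (X : V) f g : X (f * g) = X f * g + f * X g.
Proof. by case: X => X /=; rewrite inE => -[_ ->]. Qed.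

Lemma vfieldD (X : V) f g : X (f + g) = X f + X g.
Proof. by rewrite -[f in LHS]scale1r vfield_linear scale1r. Qed.

Lemma vfield0 (X : V) : X 0 = 0.
Proof. by apply: (addrI (X 0)); rewrite -vfieldD !addr0. Qed.

Lemma vfieldZ (X : V) (a : R) f : X (a *: f) = a *: X f.
Proof. by rewrite -[a *: f]addr0 vfield_linear vfield0 addr0. Qed.

Fact vfield_scale_subproof (f : F) (X : V) :
  (fun h => f * X h) \in derivation M.
Proof.
rewrite inE; split=> [a g h|g h] /=.
  rewrite vfield_linear mulrDr; congr (_ + _).
  by rewrite mulrC -smooth_scalerAl mulrC.
by rewrite vfield_leibniz mulrDr mulrA [f * (g * _)]mulrCA.
Qed.

Definition vfield_scale (f : F) (X : V) : V :=
  VField (vfield_scale_subproof f X).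

Fact vfield_scaleA f g X :
  vfield_scale f (vfield_scale g X) = vfield_scale (f * g) X.
Proof. by apply/val_inj/funext => h /=; rewrite mulrA. Qed.
Fact vfield_scale1 : left_id 1 vfield_scale.
Proof. by move=> X; apply/val_inj/funext => h /=; rewrite mul1r. Qed.
Fact vfield_scaleDr : right_distributive vfield_scale +%R.
Proof. by move=> f X Y; apply/val_inj/funext => h /=; rewrite !fctE mulrDr. Qed.
Fact vfield_scaleDl X : {morph vfield_scale^~ X : f g / f + g}.
Proof. by move=> f g; apply/val_inj/funext => h /=; rewrite !fctE mulrDl. Qed.

HB.instance Definition _ := GRing.Zmodule_isLmodule.Build F V
  vfield_scaleA vfield_scale1 vfield_scaleDr vfield_scaleDl.

Lemma vfieldDE (X Y : V) f : (X + Y) f = X f + Y f. Proof. by []. Qed.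
Lemma vfieldNE (X : V) f : (- X) f = - X f. Proof. by []. Qed.
Lemma vfieldZE (f : F) (X : V) h : (f *: X) h = f * X h. Proof. by []. Qed.

Fact bracket_subproof (X Y : V) : (fun f => X (Y f) - Y (X f)) \in derivation M.
Proof.
rewrite inE; split=> [a f g|f g] /=.
  by rewrite !vfield_linear scalerBr opprD addrACA.
rewrite !(vfield_leibniz, vfieldD) mulrBl mulrBr.
by ring.
Qed.

Definition bracket (X Y : V) : V := VField (bracket_subproof X Y).

End VFieldModule.

(** * Riemannian metrics and connections *)

Record riemannian_metric (R : realType) (m : nat) (M : manifold R m) :=
  RiemannianMetric {
  metric_fun :> vfield M -> vfield M -> smooth_fun M;
  metric_linear : forall f X Y Z,
    metric_fun (f *: X + Y) Z = f * metric_fun X Z + metric_fun Y Z;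
  metric_sym : forall X Y, metric_fun X Y = metric_fun Y X;
  (* the existential says that X does not vanish at p *)
  metric_pos : forall (X : vfield M) (p : M),
    (exists h : smooth_fun M, X h p != 0) -> 0 < metric_fun X X p }.

(* R-linearity in the second argument follows: vector fields kill constants. *)
Record connection (R : realType) (m : nat) (M : manifold R m) := Connection {
  nabla_fun :> vfield M -> vfield M -> vfield M;
  nabla_linearl : forall f X Y Z,
    nabla_fun (f *: X + Y) Z = f *: nabla_fun X Z + nabla_fun Y Z;
  nablaDr : forall X Y Z, nabla_fun X (Y + Z) = nabla_fun X Y + nabla_fun X Z;
  nabla_leibniz : forall X f Y,
    nabla_fun X (f *: Y) = X f *: Y + f *: nabla_fun X Y }.

Section TensorCalculus.
Variables (R : realType) (m : nat) (M : manifold R m).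
Local Notation F := (smooth_fun M).
Local Notation V := (vfield M).
Implicit Types (g : riemannian_metric M) (nabla : connection M) (D : set V)
  (X Y Z : V).

(* T is C^oo(M)-trilinear and alternating on D; D is to be a submodule, and
   linearity in the other two arguments follows by skew-symmetry. *)
Definition three_form_on D (T : V -> V -> V -> F) : Prop :=
  [/\ forall f X Y Z W, D X -> D Y -> D Z -> D W ->
        T (f *: X + Y) Z W = f * T X Z W + T Y Z W,
      forall X Y Z, D X -> D Y -> D Z -> T Y X Z = - T X Y Z &
      forall X Y Z, D X -> D Y -> D Z -> T X Z Y = - T X Y Z].

Definition d1 (eta : {scalar V}) (X Y : V) : F :=
  X (eta Y) - Y (eta X) - eta (bracket X Y).

Definition d2 (Phi : V -> V -> F) (X Y Z : V) : F :=
  X (Phi Y Z) + Y (Phi Z X) + Z (Phi X Y)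
  - Phi (bracket X Y) Z - Phi (bracket Y Z) X - Phi (bracket Z X) Y.

Definition wedge12 (eta : {scalar V}) (Phi : V -> V -> F) (X Y Z : V) : F :=
  eta X * Phi Y Z + eta Y * Phi Z X + eta Z * Phi X Y.

(* (L_xi phi) X *)
Definition lie_endo (xi : V) (phi : {linear V -> V}) (X : V) : V :=
  bracket xi (phi X) - phi (bracket xi X).

(* L_xi g = 0 *)
Definition killing g (xi : V) : Prop := forall X Y,
  xi (g X Y) - g (bracket xi X) Y - g X (bracket xi Y) = 0.

Definition metric_connection g nabla : Prop := forall X Y Z,
  X (g Y Z) = g (nabla X Y) Z + g Y (nabla X Z).

Definition torsion nabla (X Y : V) : V :=
  nabla X Y - nabla Y X - bracket X Y.

Definition skew_torsion g nabla : Prop :=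
  three_form_on setT (fun X Y Z => g (torsion nabla X Y) Z).

(* (nabla_X phi) Y *)
Definition nabla_endo nabla (phi : {linear V -> V}) (X Y : V) : V :=
  nabla X (phi Y) - phi (nabla X Y).

(* (nabla_X eta) Y *)
Definition nabla_form nabla (eta : {scalar V}) (X Y : V) : F :=
  X (eta Y) - eta (nabla X Y).

End TensorCalculus.

(** * Almost contact metric structures *)

Record almost_contact_metric (R : realType) (m : nat) (M : manifold R m)
    (g : riemannian_metric M) := AlmostContactMetric {
  acm_phi : {linear vfield M -> vfield M};
  acm_xi : vfield M;
  acm_eta : {scalar vfield M};
  acm_phi2 : forall X, acm_phi (acm_phi X) = - X + acm_eta X *: acm_xi;
  acm_eta_xi : acm_eta acm_xi = 1;
  acm_compatible : forall X Y,
    g (acm_phi X) (acm_phi Y) = g X Y - acm_eta X * acm_eta Y }.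

Section AlmostContact.
Variables (R : realType) (m : nat) (M : manifold R m).
Variables (g : riemannian_metric M) (S : almost_contact_metric g).
Local Notation phi := (acm_phi S).
Local Notation xi := (acm_xi S).
Local Notation eta := (acm_eta S).
Implicit Types X Y Z : vfield M.

Definition fundamental_form X Y : smooth_fun M := g X (phi Y).

Definition nijenhuis X Y : vfield M :=
  bracket (phi X) (phi Y) + phi (phi (bracket X Y))
  - phi (bracket (phi X) Y) - phi (bracket X (phi Y)) + d1 eta X Y *: xi.

Definition characteristic_connection (nabla : connection M) : Prop :=
  [/\ metric_connection g nabla, skew_torsion g nabla,
      forall X Y, nabla_form nabla eta X Y = 0 &
      forall X Y, nabla_endo nabla phi X Y = 0].

End AlmostContact.

(** * Almost 3-contact metric structures *)

(* The indices 1, 2, 3 are the elements 0, 1, 2 of 'I_3. *)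
Definition even_triple (i j k : 'I_3) : Prop :=
  exists2 s : 'S_3, ~~ odd_perm s & [/\ s 0 = i, s 1 = j & s 2 = k].

Record almost_3contact_metric (R : realType) (m : nat) (M : manifold R m) :=
  Almost3ContactMetric {
  a3_metric : riemannian_metric M;
  a3_struct :> 'I_3 -> almost_contact_metric a3_metric;
  a3_phi : forall i j k, even_triple i j k -> forall X,
    let phi l := acm_phi (a3_struct l) in
    let xi l := acm_xi (a3_struct l) in
    let eta l := acm_eta (a3_struct l) in
    phi k X = phi i (phi j X) - eta j X *: xi i /\
    phi k X = - phi j (phi i X) + eta i X *: xi j;
  a3_xi : forall i j k, even_triple i j k ->
    let phi l := acm_phi (a3_struct l) in
    let xi l := acm_xi (a3_struct l) in
    xi k = phi i (xi j) /\ xi k = - phi j (xi i);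
  a3_eta : forall i j k, even_triple i j k -> forall X,
    let phi l := acm_phi (a3_struct l) in
    let eta l := acm_eta (a3_struct l) in
    eta k X = eta i (phi j X) /\ eta k X = - eta j (phi i X) }.

Section Almost3Contact.
Variables (R : realType) (m : nat) (M : manifold R m).
Variable S : almost_3contact_metric M.
Local Notation g := (a3_metric S).
Local Notation phi i := (acm_phi (S i)).
Local Notation xi i := (acm_xi (S i)).
Local Notation eta i := (acm_eta (S i)).
Local Notation Phi i := (fundamental_form (S i)).
Implicit Types (X Y Z : vfield M) (beta : smooth_fun M).

Definition horizontal : set (vfield M) := [set X | forall i, eta i X = 0].

Definition A_tensor (i j : 'I_3) X Y : smooth_fun M :=
  g (lie_endo (xi j) (phi i) X) Y
  + d1 (eta j) X (phi i Y) + d1 (eta j) (phi i X) Y.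

Definition reeb_killing_function beta : Prop :=
  (forall i X Y, horizontal X -> horizontal Y -> A_tensor i i X Y = 0) /\
  (forall i j k, even_triple i j k ->
   forall X Y, horizontal X -> horizontal Y ->
     A_tensor i j X Y = - A_tensor j i X Y /\
     A_tensor i j X Y = beta * Phi k X Y).

Definition canonical_3contact : Prop :=
  [/\ forall i, three_form_on horizontal
        (fun X Y Z => g (nijenhuis (S i) X Y) Z),
      forall i, killing g (xi i),
      forall i j X Y Z, horizontal X -> horizontal Y -> horizontal Z ->
        g (nijenhuis (S i) X Y) Z - d2 (Phi i) (phi i X) (phi i Y) (phi i Z)
        = g (nijenhuis (S j) X Y) Z
          - d2 (Phi j) (phi j X) (phi j Y) (phi j Z) &
      exists beta, reeb_killing_function beta].

Definition canonical_connection beta (nabla : connection M) : Prop :=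
  [/\ metric_connection g nabla, skew_torsion g nabla &
      forall i j k, even_triple i j k -> forall X Y,
        nabla_endo nabla (phi i) X Y
        = beta *: (eta k X *: phi j Y - eta j X *: phi k Y)].

End Almost3Contact.

(* Main.v *)
(* Two metric connections with skew torsion differ by a 3-form.  If a 3-form D
   satisfies D(X, phi Y, Z) = - D(X, Y, phi Z), then moving phi once around the
   three slots gives D(phi X, Y, Z) = - D(phi X, Y, Z), so D vanishes on the
   image of phi; as phi^2 = - I + eta (x) xi and D is skew, D = 0 (this
   is the uniqueness of the characteristic connection).  Apply this to
     D = g(nabla - nabla^i) + beta/2 (eta_j /\ Phi_j + eta_k /\ Phi_k)
   and phi = phi_i: the commutation of D with phi_i is an algebraic consequence
   of the formula for nabla phi_i and the quaternionic relations. *)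
Require Import Defs.
From mathcomp Require Import all_boot all_order all_algebra all_fingroup.
From mathcomp Require Import all_classical all_reals all_analysis.
From mathcomp Require Import ring.

Import Order.TTheory GRing.Theory Num.Theory.

Local Open Scope ring_scope.

Lemma smooth_fun_half {R : realType} {m : nat} {M : manifold R m}
    (f : smooth_fun M) : (2^-1 : R) *: f + (2^-1 : R) *: f = f.
Proof. by rewrite -scalerDl -[2^-1]div1r -splitr scale1r. Qed.

Lemma smooth_fun_addff_eq0 {R : realType} {m : nat} {M : manifold R m}
    (f : smooth_fun M) : f + f = 0 -> f = 0.
Proof. by move=> f0; rewrite -(smooth_fun_half f) -scalerDr f0 scaler0. Qed.

(** [smooth_fun M] may have zero divisors but is reduced, since its elements take values in a
    field. *)
Lemma smooth_fun_sqr_eq0 {R : realType} {m : nat} {M : manifold R m}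
    (f : smooth_fun M) : f * f = 0 -> f = 0.
Proof.
move=> ff0; apply/val_inj/funext => p.
have /eqP : (f * f) p = 0 by rewrite ff0.
by rewrite smooth_funME mulf_eq0 orbb => /eqP.
Qed.

Section RiemannianMetric.
Context {R : realType} {m : nat} {M : manifold R m}.
Variable g : riemannian_metric M.
Implicit Types (f : smooth_fun M) (X Y Z : vfield M).

Lemma metricDl X Y Z : g (X + Y) Z = g X Z + g Y Z.
Proof. by have := metric_linear g 1 X Y Z; rewrite scale1r mul1r. Qed.

Lemma metric0l Z : g 0 Z = 0.
Proof. by apply: (addrI (g 0 Z)); rewrite -metricDl !addr0. Qed.

Lemma metricZl f X Z : g (f *: X) Z = f * g X Z.
Proof. by rewrite -[f *: X]addr0 metric_linear metric0l addr0. Qed.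

Lemma metricNl X Z : g (- X) Z = - g X Z.
Proof. by rewrite -scaleN1r metricZl mulN1r. Qed.

Lemma metricDr X Y Z : g Z (X + Y) = g Z X + g Z Y.
Proof. by rewrite !(Defs.metric_sym g Z) metricDl. Qed.

Lemma metricZr f X Z : g Z (f *: X) = f * g Z X.
Proof. by rewrite !(Defs.metric_sym g Z) metricZl. Qed.

Lemma metricNr X Z : g Z (- X) = - g Z X.
Proof. by rewrite !(Defs.metric_sym g Z) metricNl. Qed.

Lemma three_form_linear_comb (D : set (vfield M)) f T1 T2 :
  three_form_on D T1 -> three_form_on D T2 ->
  three_form_on D (fun X Y Z => T1 X Y Z + f * T2 X Y Z).
Proof.
move=> [l1 s1 t1] [l2 s2 t2]; split=> [h X Y Z W *|*|*].
- by rewrite l1// l2//; ring.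
- by rewrite s1// s2//; ring.
- by rewrite t1// t2//; ring.
Qed.

(** Both connections expand [X (g Y Z)]; the difference of the two expansions is this identity. *)
Lemma metric_connection_diff_skew (nabla1 nabla2 : connection M) X Y Z :
  metric_connection g nabla1 -> metric_connection g nabla2 ->
  g (nabla1 X Z) Y - g (nabla2 X Z) Y = - (g (nabla1 X Y) Z - g (nabla2 X Y) Z).
Proof.
move=> /(_ X Y Z) m1 /(_ X Y Z); rewrite {}m1 !(Defs.metric_sym g Y) => e.
apply/eqP; rewrite -subr_eq0; apply/eqP.
move/eqP: e; rewrite -subr_eq0 => /eqP <-; ring.
Qed.

(* D(X,Y,Z) is skew in Y, Z, and the difference of the torsions, which is
   D(X,Y,Z) + D(Y,Z,X), is invariant under cyclic permutations; hence so is D. *)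
Lemma metric_connection_diff_three_form (nabla1 nabla2 : connection M) :
  metric_connection g nabla1 -> skew_torsion g nabla1 ->
  metric_connection g nabla2 -> skew_torsion g nabla2 ->
  three_form_on setT (fun X Y Z => g (nabla1 X Y) Z - g (nabla2 X Y) Z).
Proof.
move=> m1 [_ s1 t1] m2 [_ s2 t2].
pose D X Y Z := g (nabla1 X Y) Z - g (nabla2 X Y) Z.
pose T X Y Z := g (torsion nabla1 X Y) Z - g (torsion nabla2 X Y) Z.
have Dt X Y Z : D X Z Y = - D X Y Z by exact: metric_connection_diff_skew.
have TD X Y Z : T X Y Z = D X Y Z + D Y Z X.
  by rewrite (Dt Y X Z) /T /D /torsion !metricDl !metricNl; ring.
have Tcyc X Y Z : T X Y Z = T Y Z X.
  by rewrite /T (t1 Y X Z)// (t2 Y X Z)// (s1 X Y Z)// (s2 X Y Z)// !opprK.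
have Dcyc X Y Z : D X Y Z = D Z X Y.
  have := Tcyc X Y Z; rewrite !TD [D Y Z X + _]addrC; exact: addIr.
split=> [f X Y Z W _ _ _ _|X Y Z _ _ _|X Y Z _ _ _].
- by rewrite !nabla_linearl !metric_linear; ring.
- by rewrite -/(D Y X Z) -/(D X Y Z) Dcyc Dt -Dcyc -Dcyc.
- exact: Dt.
Qed.

End RiemannianMetric.

Section AlmostContact.
Context {R : realType} {m : nat} {M : manifold R m} {g : riemannian_metric M}.
Variable S : almost_contact_metric g.
Local Notation phi := (acm_phi S).
Local Notation xi := (acm_xi S).
Local Notation eta := (acm_eta S).
Implicit Types X Y Z : vfield M.

Lemma acm_etaZ f X : eta (f *: X) = f * eta X.
Proof. by rewrite linearZ. Qed.

(** As [phi (phi xi) = 0], the formula for the square of [phi] at [phi xi] gives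
    [phi xi = eta (phi xi) *: xi]; applying [phi], then [eta], shows that the coefficient squares to
    0. *)
Lemma acm_phi_xi : phi xi = 0.
Proof.
have phi2xi : phi (phi xi) = 0.
  by rewrite acm_phi2 acm_eta_xi scale1r addNr.
have phi_xi : phi xi = eta (phi xi) *: xi.
  apply/eqP; rewrite -subr_eq0 -oppr_eq0 opprB addrC -acm_phi2 phi2xi.
  by rewrite linear0.
suff e0 : eta (phi xi) = 0 by rewrite phi_xi e0 scale0r.
apply: smooth_fun_sqr_eq0.
rewrite -acm_etaZ -[X in eta X]/(eta (phi xi) *: phi xi).
by rewrite -linearZ -phi_xi phi2xi linear0.
Qed.

(** Compatibility with second argument [xi], using [phi xi = 0]. *)
Lemma acm_metric_xi X : g X xi = eta X.
Proof.
apply/eqP; rewrite -subr_eq0 -[eta X]mulr1 -(acm_eta_xi S) -acm_compatible.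
by rewrite acm_phi_xi Defs.metric_sym metric0l.
Qed.

(** Expanding the square of [phi] in [phi (phi (phi X))] on the outside and on the inside leaves
    [eta (phi X) *: xi = 0]. *)
Lemma acm_eta_phi X : eta (phi X) = 0.
Proof.
have : phi (phi (phi X)) = - phi X.
  by rewrite (acm_phi2 S X) linearD linearN linearZ /= acm_phi_xi scaler0 addr0.
rewrite acm_phi2 -[RHS]addr0 => /addrI /(congr1 eta).
by rewrite acm_etaZ acm_eta_xi mulr1 linear0.
Qed.

(** Compatibility at [X] and [phi Y], where every [eta] term vanishes. *)
Lemma acm_phi_skew X Y : g (phi X) Y = - g X (phi Y).
Proof.
have := acm_compatible S X (phi Y).
rewrite acm_phi2 acm_eta_phi mulr0 subr0 => <-.
by rewrite metricDr metricNr metricZr acm_metric_xi acm_eta_phi mulr0 addr0 opprK.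
Qed.

Lemma fundamental_form_skew X Y :
  fundamental_form S Y X = - fundamental_form S X Y.
Proof. by rewrite /fundamental_form Defs.metric_sym acm_phi_skew. Qed.

Lemma wedge_eta_fundamental_three_form :
  three_form_on setT (wedge12 eta (fundamental_form S)).
Proof.
split=> [f X Y Z W _ _ _ _|X Y Z _ _ _|X Y Z _ _ _]; rewrite /wedge12.
- rewrite linearD acm_etaZ !(fundamental_form_skew _ W).
  by rewrite /fundamental_form !metric_linear; ring.
- rewrite (fundamental_form_skew X Y) (fundamental_form_skew Z X).
  by rewrite (fundamental_form_skew Y Z); ring.
- rewrite (fundamental_form_skew X Y) (fundamental_form_skew Z X).
  by rewrite (fundamental_form_skew Y Z); ring.
Qed.

Lemma phi_skew_three_form_eq0 T :
  three_form_on setT T ->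
  (forall X Y Z, T X (phi Y) Z = - T X Y (phi Z)) ->
  forall X Y Z, T X Y Z = 0.
Proof.
move=> [l s t] c.
have Tphi X Y Z : T (phi X) Y Z = 0.
  have phi12 : T (phi X) Y Z = - T X (phi Y) Z.
    by rewrite t// s// opprK c s// opprK t.
  have phi13 : T (phi X) Y Z = - T X Y (phi Z).
    by rewrite s// c opprK s.
  by apply: smooth_fun_addff_eq0; rewrite {1}phi12 c opprK phi13 addrN.
(* [X] and [eta X *: xi] differ by an element of the image of [phi], on which [T] vanishes. *)
have Txi X Y Z : T X Y Z = eta X * T xi Y Z.
  have XE : X = eta X *: xi + phi (- phi X).
    by rewrite linearN /= acm_phi2 opprD opprK addrCA addrN addr0.
  by rewrite {1}XE l// Tphi addr0.
move=> X Y Z; rewrite Txi.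
(* Skewness moves [Y] to the first slot, leaving a multiple of [T xi xi Z], which is its own
   opposite. *)
suff -> : T xi Y Z = 0 by rewrite mulr0.
rewrite -[T xi Y Z]opprK -s// Txi.
suff -> : T xi xi Z = 0 by rewrite mulr0 oppr0.
by apply: smooth_fun_addff_eq0; rewrite {1}s// addNr.
Qed.

End AlmostContact.

Lemma even_triple_cycle i j k : even_triple i j k -> even_triple k i j.
Proof.
case=> s s_even [s0 s1 s2].
(* Products act from left to right: the two transpositions compose to the 3-cycle 0 -> 2 -> 1 -> 0,
   which is even. *)
exists (tperm 0%R 2%R * tperm 0%R 1%R * s)%g; last first.
  by rewrite !permM tpermL tpermR tpermD// (@tpermD _ 0 2 1)// tpermL tpermR.
by rewrite !odd_permM !odd_tperm.
Qed.

Theorem theorem4p2p1 (R : realType) (n : nat) (n_ge1 : (1 <= n)%N)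
    (M : manifold R (4 * n + 3)) (S : almost_3contact_metric M)
    (canS : canonical_3contact S)
    (beta : smooth_fun M) (betaP : reeb_killing_function S beta)
    (nabla : connection M) (nablaP : canonical_connection S beta nabla)
    (nablai : 'I_3 -> connection M)
    (nablaiP : forall i, characteristic_connection (S i) (nablai i)) :
  forall i j k : 'I_3, even_triple i j k ->
  forall X Y Z : vfield M,
    a3_metric S (nabla X Y) Z
    = a3_metric S (nablai i X Y) Z
      - (2^-1 : R) *: beta *
        (wedge12 (acm_eta (S j)) (fundamental_form (S j)) X Y Z
         + wedge12 (acm_eta (S k)) (fundamental_form (S k)) X Y Z).
Proof.
move=> i j k ijk X Y Z.
have [nabla_m nabla_s nabla_phi] := nablaP.
have [nablai_m nablai_s _ nablai_phi] := nablaiP i.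
set b : smooth_fun M := _ *: beta; pose g := a3_metric S.
pose W l := wedge12 (acm_eta (S l)) (fundamental_form (S l)).
have D3 := three_form_linear_comb _ b _ _
  (three_form_linear_comb _ b _ _
     (metric_connection_diff_three_form _ _ _ nabla_m nabla_s nablai_m nablai_s)
     (wedge_eta_fundamental_three_form (S j)))
  (wedge_eta_fundamental_three_form (S k)).
suff D0 : g (nabla X Y) Z - g (nablai i X Y) Z + b * W j X Y Z + b * W k X Y Z
    = 0.
  apply/eqP; rewrite -subr_eq0; apply/eqP; rewrite -[RHS]D0 /W /g; ring.
apply: (phi_skew_three_form_eq0 (S i) _ D3) => {}X {}Y {}Z.
(* The canonical formula for the derivative of [acm_phi (S i)], with [beta] split as [b + b] so that
   [b] is the only coefficient left for [ring]. *)
have nablaE : g (nabla X (acm_phi (S i) Y)) Z =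
    g (acm_phi (S i) (nabla X Y)) Z
    + (b + b) * (acm_eta (S k) X * g (acm_phi (S j) Y) Z
                 - acm_eta (S j) X * g (acm_phi (S k) Y) Z).
  rewrite smooth_fun_half -!metricZl -metricNl -metricDl -metricZl -metricDl.
  by rewrite -(nabla_phi _ _ _ ijk) addrC subrK.
have nablaiE : g (nablai i X (acm_phi (S i) Y)) Z =
    g (acm_phi (S i) (nablai i X Y)) Z.
  by congr (g _ Z); apply/eqP; rewrite -subr_eq0; apply/eqP/nablai_phi.
have phiji V : acm_phi (S j) (acm_phi (S i) V) =
    - acm_phi (S k) V + acm_eta (S i) V *: acm_xi (S j).
  by have [_ ->] := a3_phi S ijk V; rewrite opprD opprK subrK.
(* The product with [acm_phi (S k)] on the left is read off the rotated triple [(k, i, j)]. *)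
have kij := even_triple_cycle _ _ _ ijk.
have phiki V : acm_phi (S k) (acm_phi (S i) V) =
    acm_phi (S j) V + acm_eta (S i) V *: acm_xi (S k).
  by have [-> _] := a3_phi S kij V; rewrite subrK.
have etaji V : acm_eta (S j) (acm_phi (S i) V) = - acm_eta (S k) V.
  by have [_ ->] := a3_eta S ijk V; rewrite opprK.
have etaki V : acm_eta (S k) (acm_phi (S i) V) = acm_eta (S j) V.
  by have [-> _] := a3_eta S kij V.
(* Brings both endomorphisms onto one argument, where [phiji] and [phiki] apply. *)
have phiZ l U V : g (acm_phi (S i) U) (acm_phi (S l) V) =
    - g V (acm_phi (S l) (acm_phi (S i) U)).
  by rewrite Defs.metric_sym acm_phi_skew.
rewrite nablaE nablaiE !acm_phi_skew /wedge12 /fundamental_form !phiZ !phiji !phiki.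
rewrite !etaji !etaki !metricDr !metricZr !metricNr !acm_metric_xi.
have sk l U V : g V (acm_phi (S l) U) = - g U (acm_phi (S l) V).
  by rewrite Defs.metric_sym acm_phi_skew.
(* In the wedge products the terms with [acm_eta (S i)], and those with the other two forms at [Y]
   or [Z], cancel. Those at [X] come twice, hence the factor 1/2, and cancel the derivative of
   [acm_phi (S i)]. *)
by rewrite (sk j Y Z) (sk k Y Z) (sk j X Z) (sk k X Z); ring.
Qed.
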